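(* Let $q$ be a power of a prime. For any multiplicative characters $A,A',B,B',C$ of $\mathbb{F}_q^*$, any $x,t\in\mathbb{F}_q^*\setminus\{1\}$ and any $y\in\mathbb{F}_q$, \begin{align*} &\frac{1}{q-1}\sum_{\theta}\binom{BB'\overline{C}\theta}{\theta}F_{3}(A,A';B\theta,B';C;x,y)\,\theta(t)\\ &=\overline{B}(1-t)\,F_{3}\left(A,A';B,B';C;\frac{x}{1-t},y\right)+\overline{B}\,\overline{B'}C(-t)\,F_{3}(A,A';C\overline{B'},B';C;x,y)\\ &\quad-\overline{B'}(y)\,\overline{B}(-t)\,\overline{C}B'\left(-\frac{x}{t}\right)\binom{\overline{A}}{\overline{C}B'}\binom{\overline{A'}}{\overline{B'}}, \end{align*} where the sum is over all multiplicative characters $\theta$ of $\mathbb{F}_q^*$.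
   Context: $\mathbb{F}_q$ is the finite field with $q$ elements. Characters are complex-valued multiplicative characters of $\mathbb{F}_q^*$; every character $\chi$, including the trivial character $\varepsilon$, is extended to $\mathbb{F}_q$ by $\chi(0)=0$. $\overline{\chi}$ is the inverse of $\chi$; juxtaposition of characters is their product, so that e.g. $\overline{B}\,\overline{B'}C(-t)$ means $(\overline{B}\,\overline{B'}C)(-t)$. For characters $\chi,\lambda$ the Jacobi sum is $J(\chi,\lambda)=\sum_{u\in\mathbb{F}_q}\chi(u)\lambda(1-u)$, and the binomial coefficient of characters $A,B$ is $\binom{A}{B}=B(-1)J(A,\overline{B})$ (no factor $1/q$). The finite field Appell series $F_3$ is, for characters $A,A',B,B',C$ and $x,y\in\mathbb{F}_q$, $$F_{3}(A,A';B,B';C;x,y)=\varepsilon(xy)\,BB'(-1)\sum_{u,v\in\mathbb{F}_q}B(u)\,B'(v)\,C\overline{B}\,\overline{B'}(1-u-v)\,\overline{A}(1-ux)\,\overline{A'}(1-vy).$$ *)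

(* Defs.v *)
From HB Require Import structures.
From mathcomp Require Import all_boot all_order all_algebra all_fingroup cyclic.

Set Implicit Arguments.
Unset Strict Implicit.
Unset Printing Implicit Defensive.

Import GRing.Theory.
Local Open Scope ring_scope.

Section MulChar.
Variables (F : finFieldType) (C : numClosedFieldType).

Definition is_mulchar (f : {ffun {unit F} -> C}) : bool :=
  (f 1%g == 1) && [forall u, forall v, f (u * v)%g == f u * f v].

Record mulchar := MulChar {
  mulchar_fun : {ffun {unit F} -> C};
  mulcharP : is_mulchar mulchar_fun
}.

HB.instance Definition _ := [isSub for mulchar_fun].
HB.instance Definition _ := [Choice of mulchar by <:].

Lemma mulchar_fun1 (chi : mulchar) : mulchar_fun chi 1%g = 1.
Proof. by case/andP: (mulcharP chi) => /eqP. Qed.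

Lemma mulchar_funM (chi : mulchar) u v :
  mulchar_fun chi (u * v)%g = mulchar_fun chi u * mulchar_fun chi v.
Proof. by case/andP: (mulcharP chi) => _ /forallP/(_ u)/forallP/(_ v)/eqP. Qed.

Lemma mulchar_fun_expr (chi : mulchar) u n :
  mulchar_fun chi (u ^+ n)%g = mulchar_fun chi u ^+ n.
Proof.
elim: n => [|n IHn]; first exact: mulchar_fun1.
by rewrite expgS exprS mulchar_funM IHn.
Qed.

Lemma mulchar_fun_neq0 (chi : mulchar) u : mulchar_fun chi u != 0.
Proof.
apply/eqP => chiu0; have := mulchar_fun1 chi.
by rewrite -(mulgV u) mulchar_funM chiu0 mul0r => /esym/eqP; rewrite oner_eq0.
Qed.

(* The values of characters are roots of 'X^(q-1) - 1, hence there are finitely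
   many characters. *)
Let values : seq C :=
  sval (closed_field_poly_normal ('X^(#|[set: {unit F}]|) - 1)).

Let mulchar_values (chi : mulchar) u : mulchar_fun chi u \in values.
Proof.
rewrite /values; case: closed_field_poly_normal => s /= Ds.
have n_gt0 : (0 < #|[set: {unit F}]|)%N by rewrite cardG_gt0.
have := Ds; rewrite (monicP (monicXnsubC _ n_gt0)) scale1r => {}Ds.
rewrite -root_prod_XsubC -Ds rootE !hornerE -mulchar_fun_expr.
by rewrite expg_cardG ?inE // mulchar_fun1 subrr.
Qed.

Let encode (chi : mulchar) : {ffun {unit F} -> 'I_(size values).+1} :=
  [ffun u => inord (index (mulchar_fun chi u) values)].
Let decode (h : {ffun {unit F} -> 'I_(size values).+1}) : option mulchar :=
  insub [ffun u => nth 0 values (h u)].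

Let encodeK : pcancel encode decode.
Proof.
move=> chi; rewrite /decode.
suff -> : [ffun u => nth 0 values (encode chi u)] = val chi by rewrite valK.
apply/ffunP => u; rewrite !ffunE inordK ?nth_index ?mulchar_values //.
by rewrite ltnS index_size.
Qed.

HB.instance Definition _ := PCanIsCountable encodeK.
HB.instance Definition _ : isFinite mulchar := PCanIsFinite encodeK.

Let mulchar_one_subproof : is_mulchar [ffun=> 1].
Proof.
rewrite /is_mulchar ffunE eqxx; apply/forallP => u; apply/forallP => v.
by rewrite !ffunE mulr1.
Qed.

Let mulchar_mul_subproof (chi psi : mulchar) :
  is_mulchar [ffun u => mulchar_fun chi u * mulchar_fun psi u].
Proof.
rewrite /is_mulchar ffunE !mulchar_fun1 mulr1 eqxx.
apply/forallP => u; apply/forallP => v.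
by rewrite !ffunE !mulchar_funM mulrACA.
Qed.

Let mulchar_inv_subproof (chi : mulchar) :
  is_mulchar [ffun u => (mulchar_fun chi u)^-1].
Proof.
rewrite /is_mulchar ffunE mulchar_fun1 invr1 eqxx.
apply/forallP => u; apply/forallP => v.
by rewrite !ffunE mulchar_funM invfM.
Qed.

Definition mulchar_one : mulchar := MulChar mulchar_one_subproof.
Definition mulchar_mul (chi psi : mulchar) : mulchar :=
  MulChar (mulchar_mul_subproof chi psi).
Definition mulchar_inv (chi : mulchar) : mulchar :=
  MulChar (mulchar_inv_subproof chi).

Let mulchar_mulA : associative mulchar_mul.
Proof. by move=> a b c; apply/val_inj/ffunP => u; rewrite !ffunE mulrA. Qed.
Let mulchar_mul1 : left_id mulchar_one mulchar_mul.
Proof. by move=> a; apply/val_inj/ffunP => u; rewrite !ffunE mul1r. Qed.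
Let mulchar_mulV : left_inverse mulchar_one mulchar_inv mulchar_mul.
Proof.
move=> a; apply/val_inj/ffunP => u.
by rewrite !ffunE mulVf ?mulchar_fun_neq0.
Qed.

HB.instance Definition _ :=
  Finite_isGroup.Build mulchar mulchar_mulA mulchar_mul1 mulchar_mulV.

(* Extension by 0, also for the trivial character: [mulchar_ext 1 0 = 0]. *)
Definition mulchar_ext (chi : mulchar) (x : F) : C :=
  if insub x is Some u then mulchar_fun chi u else 0.

End MulChar.

Coercion mulchar_ext : mulchar >-> Funclass.

Section Appell.
Variables (F : finFieldType) (C : numClosedFieldType).
Implicit Types (A B D chi lambda : mulchar F C).

Definition jacobi_sum chi lambda : C :=
  \sum_(u : F) chi u * lambda (1 - u).

(* Normalised without the factor 1/q. *)
Definition char_binom A B : C := B (-1) * jacobi_sum A (B^-1)%g.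

Definition appellF3 A A' B B' D (x y : F) : C :=
  (1%g : mulchar F C) (x * y) * (B * B')%g (-1) *
  \sum_(u : F) \sum_(v : F)
    B u * B' v * (D * B^-1 * B'^-1)%g (1 - u - v) *
    (A^-1)%g (1 - u * x) * (A'^-1)%g (1 - v * y).

End Appell.

(* Main.v *)
Require Import Defs.
From mathcomp Require Import all_boot all_order all_algebra all_fingroup.
From mathcomp Require Import cyclic separable finfield cyclotomic.
From mathcomp Require Import reals complex.
From mathcomp Require Import ring.

Set Implicit Arguments.
Unset Strict Implicit.
Unset Printing Implicit Defensive.

Import GRing.Theory Num.Theory.
Local Open Scope ring_scope.

(** Expand both Appell series and the binomial coefficient into sums over [F].
On the left the character [theta] then occurs only through values, and the sum
over [theta] is the finite field binomial theorem [sum_char_binom]: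
  [sum_theta binom(chi theta, theta) theta(z)
     = (q - 1) epsilon(z) chi^-1(1 - z)],
here with [chi = B B' C^-1] and [z = - u t / (1 - u - v)].  Since
[(1 - u - v) (1 - z) = 1 - v - u (1 - t)], the left-hand side becomes an
[F_3]-like double sum in which [1 - u - v] is replaced by [1 - v - u (1 - t)],
except that the terms with [1 - u - v = 0] are missing ([sum_appellF3]).

The full double sum is turned into [F_3 (x / (1 - t), y)] by rescaling [u].
The missing line [v = 1 - u] contributes a single sum, and the same single sum
appears in [F_3 (A, A'; C B'^-1, B'; C; x, y)]: there the character at
[1 - u - v] is trivial, so that series is a full double sum minus its values on
the line [v = 1 - u].  This time the full double sum is a product of two sums
in one variable, and these are Jacobi sums after rescaling
([sum_mulchar_affine]); they give the product of binomial coefficients.  What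
remains is to compare signs, with [chi(-1)^2 = 1].  For [y = 0] all terms
vanish.

The binomial theorem itself is the orthogonality relation [sum_mulchar]: the sum
over [theta] restricts the Jacobi sum to the solutions [w] of
[- z w = 1 - w], and there is at most one.  Orthogonality needs enough
characters: [F^*] is cyclic, and sending a generator to a root of unity of the
same order gives a character that separates points. *)

(** * Roots of unity *)

(** When [n] is nonzero in [K], ['X^n - 1] is separable, hence has [n] distinct
roots, which is enough for a primitive one. *)
Lemma closed_prim_root_exists (K : closedFieldType) n :
  n%:R != 0 :> K -> exists z : K, n.-primitive_root z.
Proof.
move=> n_neq0; have n_gt0 : (0 < n)%N by case: n n_neq0 => //; rewrite eqxx.
pose p : {poly K} := 'X^n - 1; have [r Dp] := closed_field_poly_normal p.
rewrite (monicP _) ?monicXnsubC // scale1r in Dp.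
have rn1 : all n.-unity_root r by apply/allP=> z; rewrite -root_prod_XsubC -Dp.
have sz_r : (n < (size r).+1)%N.
  by rewrite -(size_prod_XsubC r id) -Dp size_XnsubC.
have [|z _ prim_z] := hasP (has_prim_root n_gt0 rn1 _ sz_r); last by exists z.
by rewrite -separable_prod_XsubC -Dp separable_Xn_sub_1.
Qed.

(** * Values of extended characters *)

Section MulChar.
Variables (F : finFieldType) (K : numClosedFieldType).
Implicit Types (chi psi theta lambda : mulchar F K) (x y z a : F).

Lemma mulchar_val chi (u : {unit F}) : chi (val u) = mulchar_fun chi u.
Proof. by rewrite /mulchar_ext valK. Qed.

Lemma mulchar0 chi : chi 0 = 0.
Proof. by rewrite /mulchar_ext insubF // unitr0. Qed.

Variant mulchar_arg_spec : F -> Type :=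
  | MulcharArg0 : mulchar_arg_spec 0
  | MulcharArgUnit (u : {unit F}) : mulchar_arg_spec (val u).

Lemma mulchar_argP x : mulchar_arg_spec x.
Proof.
have [->|] := eqVneq x 0; first by left.
by rewrite -unitfE => Ux; rewrite -[x](SubK {unit F} Ux); right.
Qed.

Lemma mulcharM chi x y : chi (x * y) = chi x * chi y.
Proof.
case: (mulchar_argP x) => [|u]; first by rewrite mul0r mulchar0 mul0r.
case: (mulchar_argP y) => [|v]; first by rewrite mulr0 mulchar0 mulr0.
by rewrite -[_ * _]/(val (u * v)%g) !mulchar_val mulchar_funM.
Qed.

Lemma mulchar1 chi : chi 1 = 1.
Proof. by rewrite -[1]/(val (1%g : {unit F})) mulchar_val mulchar_fun1. Qed.

Lemma mulchar_eq0 chi x : (chi x == 0) = (x == 0).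
Proof.
case: (mulchar_argP x) => [|u]; first by rewrite mulchar0 !eqxx.
rewrite mulchar_val (negPf (mulchar_fun_neq0 _ _)).
by apply/esym/negbTE; rewrite -unitfE (valP u).
Qed.

Lemma mulcharV chi x : chi x^-1 = (chi x)^-1.
Proof.
have [->|x_neq0] := eqVneq x 0; first by rewrite invr0 mulchar0 invr0.
apply: (mulfI (x := chi x)); first by rewrite mulchar_eq0.
by rewrite -mulcharM !mulfV ?mulchar_eq0 // mulchar1.
Qed.

Lemma mulchar_mulE chi psi x : (chi * psi)%g x = chi x * psi x.
Proof.
case: (mulchar_argP x) => [|u]; first by rewrite !mulchar0 mul0r.
by rewrite !mulchar_val ffunE.
Qed.

Lemma mulchar_invE chi x : (chi^-1)%g x = (chi x)^-1.
Proof.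
case: (mulchar_argP x) => [|u]; first by rewrite !mulchar0 invr0.
by rewrite !mulchar_val ffunE.
Qed.

Lemma mulchar_oneE x : (1%g : mulchar F K) x = (x != 0)%:R.
Proof.
case: (mulchar_argP x) => [|u]; first by rewrite mulchar0 eqxx.
by rewrite mulchar_val ffunE -unitfE (valP u).
Qed.

Lemma mulcharN1_sqr chi : chi (-1) * chi (-1) = 1.
Proof. by rewrite -mulcharM mulrNN mulr1 mulchar1. Qed.

Lemma mulcharN1V chi : (chi (-1))^-1 = chi (-1).
Proof. by rewrite -mulcharV invrN1. Qed.

Lemma mulcharN chi x : chi (- x) = chi (-1) * chi x.
Proof. by rewrite -mulcharM mulN1r. Qed.

(** * Orthogonality of characters *)

(** Sending a generator of the cyclic group [F^*], of order [n], to a primitive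
[n]-th root of unity defines an injective character. *)
Lemma mulchar_separates a : a != 0 -> a != 1 -> exists theta, theta a != 1.
Proof.
case: (mulchar_argP a) => [|u _]; first by rewrite eqxx.
rewrite -[1]/(val (1%g : {unit F})) (inj_eq val_inj) => u_neq1.
have /cyclicP[g Dg] := field_unit_group_cyclic [set: {unit F}]%G.
have [|zeta prim_zeta] := @closed_prim_root_exists K #[g]%g.
  by rewrite pnatr_eq0 -lt0n order_gt0.
have logP v : {i | v = (g ^+ i)%g}.
  have [|i _ ->] := @cyclePmin _ g v; last by exists i.
  by rewrite -Dg inE.
pose f : {ffun {unit F} -> K} := [ffun v => zeta ^+ sval (logP v)].
have fE i : f (g ^+ i)%g = zeta ^+ i.
  rewrite ffunE; case: (logP _) => j /= /eqP Dj.
  by apply/eqP; rewrite (eq_prim_root_expr prim_zeta) -eq_expg_mod_order eq_sym.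
have f_mulchar : is_mulchar f.
  rewrite /is_mulchar -[in f 1%g](expg0 g) fE eqxx.
  apply/forallP=> v; apply/forallP=> w.
  have [[i Dv] [j Dw]] := (logP v, logP w); rewrite {}Dv {}Dw.
  by rewrite -expgD !fE exprD.
exists (MulChar f_mulchar); rewrite mulchar_val /=.
have [i Du] := logP u; rewrite Du in u_neq1 *.
by rewrite fE -(prim_order_dvd prim_zeta) order_dvdn.
Qed.

(** If [chi u != 1], multiplying the variable by [u] multiplies the sum by
[chi u], so the sum vanishes. *)
Lemma sum_mulchar_val chi :
  \sum_(x : F) chi x = if chi == 1%g then #|F|%:R - 1 else 0.
Proof.
have [->|chi_neq1] := eqVneq.
  rewrite (bigD1 0) //= mulchar0 add0r.
  under eq_bigr => x x_neq0 do rewrite mulchar_oneE x_neq0.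
  by rewrite sumr_const (cardC1 (0 : F)) -subn1 natrB // (cardD1 (0 : F)).
have [u chi_u] : exists u : {unit F}, mulchar_fun chi u != 1.
  apply/existsP; rewrite -negb_forall; apply: contra chi_neq1 => /forallP chi1.
  by apply/eqP/val_inj/ffunP => u; rewrite ffunE; apply/eqP/chi1.
have u_neq0 : val u != 0 by rewrite -unitfE (valP u).
apply: (mulfI (x := chi (val u) - 1)); first by rewrite subr_eq0 mulchar_val.
rewrite mulr0 mulrBl mul1r mulr_sumr [X in _ - X](reindex_inj (mulfI u_neq0)).
by under [X in _ - X]eq_bigr do rewrite mulcharM; rewrite subrr.
Qed.

Lemma sum_mulchar_neq1 a : a != 1 -> \sum_theta (theta : mulchar F K) a = 0.
Proof.
have [-> _|a_neq0 a_neq1] := eqVneq a 0.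
  by apply: big1 => theta _; rewrite mulchar0.
have [psi psi_a] := mulchar_separates a_neq0 a_neq1.
apply: (mulfI (x := psi a - 1)); first by rewrite subr_eq0.
rewrite mulr0 mulrBl mul1r mulr_sumr [X in _ - X](reindex_inj (mulgI psi)).
by under [X in _ - X]eq_bigr do rewrite mulchar_mulE; rewrite subrr.
Qed.

(** At [a = 1] the sum is the number of characters.  It is found by computing
the sum of all [theta x] in both orders: summing over [x] first leaves only the
trivial character, summing over [theta] first leaves only [x = 1]. *)
Lemma sum_mulchar a :
  \sum_theta (theta : mulchar F K) a = (#|F|%:R - 1) * (a == 1)%:R.
Proof.
have [->|/sum_mulchar_neq1->] := eqVneq a 1; last by rewrite mulr0.
have <- : \sum_(x : F) \sum_theta (theta : mulchar F K) x = #|F|%:R - 1.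
  rewrite exchange_big /=; under eq_bigr => theta _ do rewrite sum_mulchar_val.
  by rewrite -big_mkcond big_pred1_eq.
rewrite mulr1 [RHS](bigD1 1) //= [X in _ + X]big1 ?addr0 // => x.
exact: sum_mulchar_neq1.
Qed.

(** * The binomial theorem and Jacobi sums *)

(** The binomial theorem over a finite field, which corresponds to
[sum_k binom(a + k, k) z^k = (1 - z)^(- a - 1)].  Exchanging the sum over
[theta] with the one in the Jacobi sum leaves the values of [chi] at the [w]
with [- z w = 1 - w], that is, at [w = (1 - z)^-1]. *)
Lemma sum_char_binom chi z :
  \sum_theta char_binom (chi * theta)%g theta * theta z
  = (#|F|%:R - 1) * ((1%g : mulchar F K) z * (chi^-1)%g (1 - z)).
Proof.
transitivity (\sum_(w : F) chi w * \sum_theta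
                 (theta : mulchar F K) (- (z * w / (1 - w)))).
  under [RHS]eq_bigr do rewrite mulr_sumr.
  rewrite exchange_big; apply: eq_bigr => theta _.
  rewrite /char_binom /jacobi_sum mulr_sumr mulr_suml; apply: eq_bigr => w _.
  by rewrite mulchar_mulE mulchar_invE mulcharN !mulcharM mulcharV; ring.
under eq_bigr do rewrite sum_mulchar mulrCA.
rewrite -mulr_sumr; congr (_ * _); rewrite mulchar_oneE mulchar_invE -mulcharV.
have [->|z_neq0] := eqVneq z 0.
  rewrite mul0r big1 // => w _.
  by rewrite !mul0r oppr0 eq_sym oner_eq0 mulr0.
rewrite mul1r.
(* At w = 1 both sides are false: the fraction is 0, and z is not. *)
have solP w : (- (z * w / (1 - w)) == 1) = (w * (1 - z) == 1).
  have [->|w_neq1] := eqVneq w 1.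
    rewrite subrr invr0 mulr0 oppr0 mul1r eq_sym oner_eq0 -subr_eq0.
    by rewrite addrAC subrr add0r oppr_eq0 (negPf z_neq0).
  have w1_neq0 : 1 - w != 0 by rewrite subr_eq0 eq_sym.
  rewrite -mulNr -(inj_eq (mulIf w1_neq0)) mulfVK // mul1r.
  rewrite -subr_eq0 -[RHS]subr_eq0; congr (_ == 0); ring.
have [z_eq1|z_neq1] := eqVneq z 1.
  rewrite [in RHS]z_eq1 subrr invr0 mulchar0 big1 // => w _.
  by rewrite solP z_eq1 subrr mulr0 eq_sym oner_eq0 mulr0.
have z1_neq0 : 1 - z != 0 by rewrite subr_eq0 eq_sym.
rewrite (bigD1 (1 - z)^-1) //= solP mulVf // eqxx mulr1.
rewrite [X in _ + X]big1 ?addr0 // => w w_neq.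
rewrite -(inj_eq (mulIf z1_neq0)) mulVf // in w_neq.
by rewrite solP (negPf w_neq) mulr0.
Qed.

(** Rescaling by [x] and reflecting [u] into [1 - u] gives the Jacobi sum; the
factor [chi (-1)] in the normalisation of the binomial coefficient is absorbed
by the sign in [chi (- x)]. *)
Lemma sum_mulchar_affine chi lambda x : x != 0 ->
  \sum_(u : F) (chi^-1)%g u * lambda (1 - u * x)
  = chi (- x) * char_binom lambda chi.
Proof.
move=> x_neq0; rewrite /char_binom mulcharN mulrCA !mulrA mulcharN1_sqr mul1r.
rewrite /jacobi_sum mulr_sumr.
rewrite (reindex_inj (mulIf (invr_neq0 x_neq0))) (reindex_inj (subrI 1)) /=.
apply: eq_bigr => u _; rewrite mulfVK // subKr mulcharM mulcharV !mulchar_invE.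
by rewrite invrK; ring.
Qed.

(** The trivial character is the indicator of the nonzero elements, so it removes
the term [v = a]. *)
Lemma sum_mul_trivial_mulchar (g : F -> K) a :
  \sum_(v : F) g v * (1%g : mulchar F K) (a - v) = \sum_v g v - g a.
Proof.
rewrite [RHS](_ : _ = \sum_(v | v != a) g v); last first.
  by rewrite [X in X - _](bigD1 a) //= addrAC subrr add0r.
rewrite [RHS]big_mkcond; apply: eq_bigr => v _.
by rewrite mulchar_oneE subr_eq0 eq_sym; case: eqP; rewrite ?mulr1 ?mulr0.
Qed.

(** * The Appell series *)

(** The binomial theorem applied inside the double sum, at
[z = - u t / (1 - u - v)].  The trivial character at [1 - u - v] records that
the terms with [1 - u - v = 0] are absent from the series on the left,
although the new argument [1 - v - u (1 - t)] may be nonzero there. *)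
Lemma sum_appellF3 (A A' B B' D : mulchar F K) x y t : t != 0 ->
  \sum_(theta : mulchar F K)
     char_binom (B * B' * D^-1 * theta)%g theta *
     appellF3 A A' (B * theta)%g B' D x y * theta t
  = (#|F|%:R - 1) * ((1%g : mulchar F K) (x * y) * (B * B')%g (-1) *
      \sum_(u : F) \sum_(v : F)
        B u * B' v * (D * B^-1 * B'^-1)%g (1 - v - u * (1 - t)) *
        (A^-1)%g (1 - u * x) * (A'^-1)%g (1 - v * y) *
        (1%g : mulchar F K) (1 - u - v)).
Proof.
move=> t_neq0; set e := (1%g : mulchar F K) (x * y).
pose z u v : F := - (u * t / (1 - u - v)).
pose G u v := e * (B * B')%g (-1) *
  (B u * B' v * (D * B^-1 * B'^-1)%g (1 - u - v) *
     (A^-1)%g (1 - u * x) * (A'^-1)%g (1 - v * y)).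
transitivity (\sum_(theta : mulchar F K) \sum_u \sum_v
    G u v * (char_binom (B * B' * D^-1 * theta)%g theta * theta (z u v))).
  apply: eq_bigr => theta _; rewrite /appellF3 -/e !(mulr_sumr, mulr_suml).
  apply: eq_bigr => u _; rewrite !(mulr_sumr, mulr_suml); apply: eq_bigr => v _.
  rewrite /G /z mulcharN !mulchar_mulE !mulchar_invE !mulchar_mulE invfM.
  rewrite !mulcharM !mulcharV; ring.
rewrite exchange_big !mulr_sumr; apply: eq_bigr => u _.
rewrite exchange_big !mulr_sumr; apply: eq_bigr => v _.
rewrite -mulr_sumr sum_char_binom /G.
suff core : B u * (D * B^-1 * B'^-1)%g (1 - u - v) *
    ((1%g : mulchar F K) (z u v) * ((B * B' * D^-1)^-1)%g (1 - z u v)) =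
    B u * (D * B^-1 * B'^-1)%g (1 - v - u * (1 - t)) *
    (1%g : mulchar F K) (1 - u - v).
  ring: core.
have [->|u_neq0] := eqVneq u 0; first by rewrite mulchar0 !mul0r.
have [s_eq0|s_neq0] := eqVneq (1 - u - v) 0.
  by rewrite s_eq0 !mulchar0 !mulr0 !mul0r.
have z_neq0 : z u v != 0.
  by rewrite oppr_eq0 !mulf_neq0 ?invr_eq0.
have -> : 1 - v - u * (1 - t) = (1 - u - v) * (1 - z u v).
  by rewrite /z; field.
rewrite mulcharM !mulchar_oneE z_neq0 s_neq0 mul1r mulr1 -mulrA.
congr (_ * (_ * _)).
by rewrite !(mulchar_invE, mulchar_mulE) !invfM invrK; ring.
Qed.

End MulChar.

Theorem theorem4p3 (R : realType) (F : finFieldType)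
    (A A' B B' C : mulchar F R[i]) (x t y : F)
    (x_neq0 : x != 0) (x_neq1 : x != 1) (t_neq0 : t != 0) (t_neq1 : t != 1) :
  (#|F|%:R - 1)^-1 *
    (\sum_(theta : mulchar F R[i])
       char_binom (B * B' * C^-1 * theta)%g theta *
       appellF3 A A' (B * theta)%g B' C x y * theta t)
  = (B^-1)%g (1 - t) * appellF3 A A' B B' C (x / (1 - t)) y
    + (B^-1 * B'^-1 * C)%g (- t) * appellF3 A A' (C * B'^-1)%g B' C x y
    - (B'^-1)%g y * (B^-1)%g (- t) * (C^-1 * B')%g (- (x / t)) *
      char_binom (A^-1)%g (C^-1 * B')%g * char_binom (A'^-1)%g (B'^-1)%g.
Proof.
have q1_neq0 : #|F|%:R - 1 != 0 :> R[i].
  by rewrite subr_eq0 -[1]/(1%:R) eqr_nat neq_ltn finNzRing_gt1 orbT.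
rewrite sum_appellF3 // mulKf // /appellF3.
have [->|y_neq0] := eqVneq y 0.
  by rewrite !mulr0 !mulchar0 !mul0r !mulr0 subr0 addr0.
have t1_neq0 : 1 - t != 0 by rewrite subr_eq0 eq_sym.
have e1 z : z != 0 -> (1%g : mulchar F R[i]) (z * y) = 1.
  by move=> z_neq0; rewrite mulchar_oneE mulf_neq0.
rewrite !e1 ?mulf_neq0 ?invr_eq0 // !mul1r.
pose P u := (A^-1)%g (1 - u * x); pose Q v := (A'^-1)%g (1 - v * y).
pose S1 := \sum_(u : F) \sum_(v : F)
  B u * B' v * (C * B^-1 * B'^-1)%g (1 - v - u * (1 - t)) * P u * Q v.
(* The sum over the line v = 1 - u, shared by the left-hand side, where
   1 - v - u (1 - t) is u t on that line, and by the second series. *)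
pose diag := \sum_(u : F) C u * (B' u)^-1 * B' (1 - u) * P u * Q (1 - u).
have defL : \sum_(u : F) \sum_(v : F)
    B u * B' v * (C * B^-1 * B'^-1)%g (1 - v - u * (1 - t)) * P u * Q v *
    (1%g : mulchar F R[i]) (1 - u - v) =
  S1 - (C * B^-1 * B'^-1)%g t * diag.
  under eq_bigr do rewrite sum_mul_trivial_mulchar.
  rewrite sumrB mulr_sumr; congr (_ - _); apply: eq_bigr => u _.
  have [->|u_neq0] := eqVneq u 0; first by rewrite !mulchar0 !mul0r mulr0.
  have -> : 1 - (1 - u) - u * (1 - t) = u * t by ring.
  rewrite !mulcharM !mulchar_mulE !mulchar_invE.
  by field; rewrite !mulchar_eq0 u_neq0 t_neq0.
have defR1 : \sum_(u : F) \sum_(v : F)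
    B u * B' v * (C * B^-1 * B'^-1)%g (1 - u - v) *
    (A^-1)%g (1 - u * (x / (1 - t))) * (A'^-1)%g (1 - v * y) =
  B (1 - t) * S1.
  rewrite (reindex_inj (mulIf t1_neq0)) /= mulr_sumr; apply: eq_bigr => u _.
  rewrite mulr_sumr; apply: eq_bigr => v _; rewrite mulcharM.
  have -> : u * (1 - t) * (x / (1 - t)) = u * x by field.
  by rewrite /P /Q [1 - _ - v]addrAC; ring.
have defR2 : \sum_(u : F) \sum_(v : F)
    (C * B'^-1)%g u * B' v * (C * (C * B'^-1)^-1 * B'^-1)%g (1 - u - v) *
    (A^-1)%g (1 - u * x) * (A'^-1)%g (1 - v * y) =
  (C^-1 * B')%g (- x) * char_binom (A^-1)%g (C^-1 * B')%g *
    ((B'^-1)%g (- y) * char_binom (A'^-1)%g (B'^-1)%g) - diag.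
  have trivE w : (C * (C * B'^-1)^-1 * B'^-1)%g w = (1%g : mulchar F R[i]) w.
    have [->|w_neq0] := eqVneq w 0; first by rewrite !mulchar0.
    rewrite mulchar_oneE w_neq0 /= !(mulchar_mulE, mulchar_invE).
    by field; rewrite !mulchar_eq0 w_neq0.
  transitivity (\sum_(u : F) \sum_(v : F)
    (C * B'^-1)%g u * B' v * P u * Q v * (1%g : mulchar F R[i]) (1 - u - v)).
    apply: eq_bigr => u _; apply: eq_bigr => v _; rewrite trivE /P /Q; ring.
  under eq_bigr do rewrite sum_mul_trivial_mulchar.
  rewrite sumrB; congr (_ - _); last first.
    by apply: eq_bigr => u _; rewrite mulchar_mulE mulchar_invE.
  rewrite -!sum_mulchar_affine // mulr_suml; apply: eq_bigr => u _.
  rewrite mulr_sumr; apply: eq_bigr => v _.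
  by rewrite /P /Q !(mulchar_invE, mulchar_mulE) invfM !invrK; ring.
rewrite [X in _ * X = _]defL defR1 defR2.
have b_sqr := mulcharN1_sqr B; have b'_sqr := mulcharN1_sqr B'.
have c_sqr := mulcharN1_sqr C.
rewrite !(mulchar_mulE, mulchar_invE).
rewrite !(mulcharN _ t, mulcharN _ x, mulcharN _ y, mulcharN _ (x / t)).
rewrite !mulcharM !mulcharV !invfM !mulcharN1V invrK.
rewrite [X in _ = X + _ - _](_ : _ = B (-1) * B' (-1) * S1).
  by ring: b_sqr b'_sqr c_sqr.
by rewrite mulrCA mulKf // mulchar_eq0.
Qed.
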